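(* The following are equivalent: (1) Artin's conjecture is true at $s_0$, i.e. $\mathbb F[H(s_0)]=\mathbb F[x_1,\ldots,x_r]$. (2) $I_{H(s_0)}=(0)$ and for any $1\le t\le r-1$ we have $L_t\ge N_t$. (3) $I_{H(s_0)}=(0)$ and there exists $1\le t\le r-1$ such that $L_t\ge N_t$.
   Context: Let $K/\mathbb Q$ be a finite Galois extension with Galois group $G$, let $\chi_1,\ldots,\chi_r$ be the irreducible complex characters of $G$, and let $f_j(s)=L(s,\chi_j,K/\mathbb Q)$, $1\le j\le r$, be their Artin L-functions (meromorphic on $\mathbb C$). Fix $s_0\in\mathbb C\setminus\{1\}$ and let $\ell_j:=\operatorname{ord}_{s=s_0}f_j\in\mathbb Z$ be the order of $s_0$ as a zero of $f_j$ (negative if $f_j$ has a pole at $s_0$). Artin's conjecture at $s_0$ is the statement that $f_1,\ldots,f_r$ are all holomorphic at $s_0$. Let $\mathbb F$ be a field with $\mathbb C\subseteq\mathbb F\subseteq\mathcal M_{<1}$, where $\mathcal M_{<1}$ is the field of meromorphic functions on $\mathbb C$ of order $<1$. Let $H(s_0)$ be the set of $(a_1,\ldots,a_r)\in\mathbb N^r$ (with $0\in\mathbb N$) such that $L(s,a_1\chi_1+\cdots+a_r\chi_r)=f_1^{a_1}\cdots f_r^{a_r}$ is holomorphic at $s_0$, i.e. $H(s_0)=\{a\in\mathbb N^r: a_1\ell_1+\cdots+a_r\ell_r\ge 0\}$; it is a finitely generated semigroup. Let $\mathbb F[H(s_0)]\subseteq\mathbb F[x_1,\ldots,x_r]$ be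 the $\mathbb F$-subalgebra spanned by the monomials $x_1^{a_1}\cdots x_r^{a_r}$ with $(a_1,\ldots,a_r)\in H(s_0)$. Let $\{u_1,\ldots,u_m\}$ be the minimal set of monomials generating $\mathbb F[H(s_0)]$ as an $\mathbb F$-algebra. The toric ideal is $I_{H(s_0)}:=\ker\Phi$, where $\Phi:\mathbb F[t_1,\ldots,t_m]\to\mathbb F[H(s_0)]$ is the $\mathbb F$-algebra epimorphism with $\Phi(t_i)=u_i$. The support of a monomial $v$ is $\operatorname{supp}(v):=\{x_j: x_j\mid v\}$. For any $1\le t\le r-1$, $$N_t:=\min\left\{\binom{r-1}{t-1}+\binom{r-2}{t}+1,\ \binom{r}{t}\right\},$$ $$L_t:=\left|\{\operatorname{supp}(v): v\in\mathbb F[H(s_0)]\text{ a monomial},\ |\operatorname{supp}(v)|=t\}\right|,$$ where $\binom{n}{k}=0$ if $k>n$.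
   Formalization: The formal theorem assumes r ≥ 2; for r = 1 (K = Q, f_1 the zeta function, s_0 ≠ 1) conditions (1) and (2) hold while (3) fails, since no t satisfies 1 ≤ t ≤ r−1. *)

(* Defs.v *)
From HB Require Import structures.
From mathcomp Require Import all_boot all_order all_algebra.
From mathcomp Require Import all_fingroup all_field all_character.
From mathcomp Require Import all_classical all_reals all_analysis.
From mathcomp Require Import complex.
From mathcomp Require mpoly.
Import -(notations) mpoly.

Set Implicit Arguments.
Unset Strict Implicit.
Unset Printing Implicit Defensive.

Import Order.TTheory GRing.Theory Num.Theory.
Import numFieldNormedType.Exports.

Local Open Scope classical_set_scope.
Local Open Scope ring_scope.

(* The algebraic structures are those of R[i]; the regular-module alias R[i]^o
   is what carries the topology and the notion of complex derivative. *)
Notation Cplx R := ((complex (Real.sort R))^o).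

(* Meromorphic functions are represented by total functions whose values on a
   closed discrete set are irrelevant: every notion below only looks at
   punctured neighbourhoods. *)
Section Meromorphic.
Variable R : realType.
Local Notation C := (Cplx R).
Implicit Types (f g : C -> C) (z w : C).

Definition regular_at f z : Prop := \forall w \near z, derivable f w 1.

(* f is holomorphic at z up to a removable singularity *)
Definition holomorphic_at f z : Prop :=
  exists2 g, regular_at g z & \forall w \near z^', f w = g w.

Definition meromorphic_at f z : Prop :=
  exists n : nat, exists2 g, regular_at g z &
    \forall w \near z^', f w = g w / (w - z) ^+ n.

Definition meromorphic f : Prop := forall z, meromorphic_at f z.

Definition mero_eq f g : Prop := forall z, \forall w \near z^', f w = g w.

(* ord_z f = l; no l satisfies this when f vanishes identically near z *)
Definition has_order f z (l : int) : Prop :=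
  exists g, [/\ regular_at g z, g z != 0 &
                \forall w \near z^', f w = (w - z) ^ l * g w].

Definition order_at f z : int := xget (0 : int) [set l : int | has_order f z l].

Definition pole_order f z : nat := `|Num.min (0 : int) (order_at f z)|%N.

Definition cabs z : R := complex.Re `|z|.

Definition cexp z : C :=
  Complex (expR (complex.Re z) * cos (complex.Im z))
          (expR (complex.Re z) * sin (complex.Im z)).

(* Nevanlinna theory: n(t, f), N(r, f), m(r, f), T(r, f), and the order of
   growth limsup log^+ T(r, f) / log r. *)
Definition pole_count f (t : R) : R :=
  \sum_(z \in [set z : C | cabs z <= t]) ((pole_order f z)%:R : R).

Definition counting_fun f (r : R) : R :=
  Rintegral lebesgue_measure `[0, r]
    (fun t => (pole_count f t - pole_count f 0) / t)
  + pole_count f 0 * ln r.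

Definition logp (x : R) : R := Num.max 0 (ln x).

Definition proximity_fun f (r : R) : R :=
  (2 * pi)^-1 * Rintegral lebesgue_measure `[0, 2 * pi]
    (fun theta => logp (cabs (f (Complex (r * cos theta) (r * sin theta))))).

Definition nevanlinna_char f (r : R) : R :=
  proximity_fun f r + counting_fun f r.

Definition growth_order f : \bar R :=
  limf_esup (fun r : R => (logp (nevanlinna_char f r) / ln r)%:E)
            (pinfty_nbhs R).

End Meromorphic.

(* F is a field with C <= F <= M_{<1}: cst is the inclusion of the constants
   and ev sends an element of F to (a representative of) the corresponding
   meromorphic function of order < 1.  As F is a field, ev is automatically
   injective modulo mero_eq. *)
Definition field_between (R : realType) (F : fieldType)
    (cst : {rmorphism complex R -> F}) (ev : F -> Cplx R -> Cplx R) : Prop :=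
  [/\ forall x, meromorphic (ev x) /\ (growth_order (ev x) < 1)%E,
      forall c, mero_eq (ev (cst c)) (fun=> c),
      forall x y, mero_eq (ev (x + y)) (fun w => ev x w + ev y w) &
      forall x y, mero_eq (ev (x * y)) (fun w => ev x w * ev y w)].

Section ArtinL.
Variables (R : realType) (K : splittingFieldType rat).
Local Notation C := (Cplx R).
Local Notation gT := (gal_of {:K}).
Local Notation G := ('Gal({:K} / 1))%G.

Definition ring_of_integers : set K :=
  [set x | integralOver (intr : int -> K) x].

Definition int_ideal (P : set K) : Prop :=
  [/\ P `<=` ring_of_integers, P 0,
      forall x y, P x -> P y -> P (x + y) &
      forall a x, ring_of_integers a -> P x -> P (a * x)].

Definition prime_ideal (P : set K) : Prop :=
  [/\ int_ideal P, ~ P 1 &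
      forall x y, ring_of_integers x -> ring_of_integers y ->
        P (x * y) -> P x \/ P y].

Definition lies_over (P : set K) (p : nat) : Prop := prime_ideal P /\ P p%:R.

Definition decomposition_group (P : set K) : {set gT} :=
  [set s in G | `[< forall x, P x <-> P (s x) >]].

Definition inertia_group (P : set K) : {set gT} :=
  [set s in decomposition_group P
    | `[< forall x, ring_of_integers x -> P (s x - x) >]].

Definition is_frobenius (p : nat) (P : set K) (s : gT) : Prop :=
  s \in decomposition_group P /\
  forall x, ring_of_integers x -> P (s x - x ^+ p).

(* The matrix of rho(s) restricted to the subspace V^I of vectors fixed by the
   inertia group I of P.  in_submod and val_submod are the coordinates on, and
   the inclusion of, a row space. *)
Definition inertia_invariants_mx n (rho : mx_representation (complex R) G n)
    (P : set K) (s : gT) : 'M[complex R]_(\rank (rfix_mx rho (inertia_group P))) :=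
  in_submod (rfix_mx rho (inertia_group P)) (val_submod 1%:M *m rho s).

(* p^(-s) *)
Definition prime_powN (p : nat) (s : C) : C :=
  cexp (- s * Complex (ln (p%:R : R)) 0).

(* det(1 - p^(-s) rho(phi) | V^I)^-1 *)
Definition euler_factor n (rho : mx_representation (complex R) G n)
    (p : nat) (P : set K) (phi : gT) (s : C) : C :=
  (\det (1%:M - (prime_powN p s : complex R) *:
                  inertia_invariants_mx rho P phi))^-1.

(* Matrices act on row vectors on the right, and the product of gal_of is
   composition in the opposite order; the two conventions cancel, so that
   these are the usual characters of the Galois group. *)
Definition affords n (rho : mx_representation (complex R) G n)
    (chi : {ffun gT -> complex R}) : Prop :=
  forall s, \tr (rho s) = chi s.

Definition irreducible_character (chi : {ffun gT -> complex R}) : Prop :=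
  exists n (rho : mx_representation (complex R) G n),
    mx_irreducible rho /\ affords rho chi.

(* f is the Artin L-function of chi: the meromorphic function on C that is
   given by the Euler product on Re s > 1.  The Euler factors do not depend on
   the representation, on the primes P p nor on the Frobenius elements phi p. *)
Definition artin_L_function (chi : {ffun gT -> complex R}) (f : C -> C) : Prop :=
  meromorphic f /\
  exists n (rho : mx_representation (complex R) G n)
         (P : nat -> set K) (phi : nat -> gT),
    [/\ affords rho chi,
        forall p, prime p -> lies_over (P p) p /\ is_frobenius p (P p) (phi p) &
        forall s : C, 1 < complex.Re s ->
          (fun N => \prod_(0 <= p < N | prime p)
                      euler_factor rho p (P p) (phi p) s : C) @ \oo --> f s].

End ArtinL.

(* H(s0), as a set of exponent vectors *)
Definition holomorphy_semigroup (R : realType) (r : nat)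
    (f : 'I_r -> Cplx R -> Cplx R) (s0 : Cplx R) : set (multinom r) :=
  [set a : multinom r | holomorphic_at (fun s => \prod_(j < r) f j s ^+ a j) s0].

Section Toric.
Variables (F : fieldType) (r : nat).
Local Notation mon := (multinom r).
Local Notation pol := (mpoly r F).
Local Notation X a := (mpolyX F a).

Definition generated_subalg (U : set pol) : set pol :=
  [set x | forall S : {pred pol},
     GRing.subalg_closed S -> (forall y, U y -> y \in S) -> x \in S].

(* F[H]: the linear span of the monomials with exponent in H *)
Definition semigroup_alg (H : set mon) : set pol :=
  [set p | exists (s : seq mon) (c : mon -> F),
     (forall a, a \in s -> H a) /\ p = \sum_(a <- s) c a *: X a].

Definition monomials_generate (H U : set mon) : Prop :=
  generated_subalg [set X a | a in U] = semigroup_alg H.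

Definition minimal_monomial_generators (H U : set mon) : Prop :=
  monomials_generate H U /\
  forall V, V `<=` U -> monomials_generate H V -> V = U.

(* The kernel of F[t_1, ..., t_m] -> F[x_1, ..., x_r], t_i |-> x^(u i) *)
Definition toric_ideal (m : nat) (u : 'I_m -> mon) : set (mpoly m F) :=
  [set p | mmap (@mpolyC r F) (fun i => X (u i)) p = 0].

Definition mon_supp (a : mon) : {set 'I_r} := [set j | (0 < a j)%N].

Definition L_ (H : set mon) (t : nat) : nat :=
  #|[set A : {set 'I_r} | `[< exists2 a, semigroup_alg H (X a) &
                               mon_supp a = A /\ #|A| = t >]]%SET|.

End Toric.
Arguments semigroup_alg F {r} H.
Arguments minimal_monomial_generators F {r} H U.
Arguments toric_ideal F {r m} u.
Arguments L_ F {r} H t.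

Definition N_ (r t : nat) : nat :=
  minn ('C(r.-1, t.-1) + 'C(r.-2, t) + 1) 'C(r, t).

(* Main.v *)
Require Import Defs.
From HB Require Import structures.
From mathcomp Require Import all_boot all_order all_algebra.
From mathcomp Require Import all_fingroup all_field all_character.
From mathcomp Require Import all_classical all_reals all_analysis.
From mathcomp Require Import complex.
From mathcomp Require mpoly.
From mathcomp Require Import zify.
Import -(notations) mpoly.

Set Implicit Arguments.
Unset Strict Implicit.
Unset Printing Implicit Defensive.

Import Order.TTheory GRing.Theory Num.Theory.
Import numFieldNormedType.Exports.

Local Open Scope classical_set_scope.
Local Open Scope ring_scope.

(** Orders of vanishing are additive on products, so [H(s0)] is the set of the
    exponent vectors [a] of nonnegative weight [a_1 l_1 + ... + a_r l_r], and
    holomorphy of [f_j] at [s0] means [0 <= l_j]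
    ([holomorphy_semigroupE], [holomorphic_at_order]). The rest is a statement
    about this semigroup. A toric ideal is spanned by binomials, so it is zero
    exactly when the generators [u_i] are free, that is, when an exponent vector
    is a combination of the [u_i] in at most one way ([toric_ideal_eq0P]).

    If all [l_j] are nonnegative then the semigroup is everything, its minimal
    generators are the unit vectors, which are free, and each subset of the
    variables is a support, so [L_t = 'C(r, t) >= N_t].

    Conversely, let the generators be free and suppose [l_n < 0]. Two distinct
    indices [p], [q] with [0 < l_p] and [0 < l_q] would yield a vector with two
    decompositions ([free_at_most_one_positive]). So there is [p != n] such that
    [l_j <= 0] for all [j != p], and an element of the semigroup whose support
    contains [n] must also have [p] in its support. A support of size [t]
    thus contains [p] or avoids both [p] and [n], whence
    [L_t <= 'C(r-1, t-1) + 'C(r-2, t)] ([L_le]), which is less than [N_t] for each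
    [t] between [1] and [r - 1] ([N_gt]). *)

(** * Orders of vanishing *)

Section OrderOfVanishing.
Variable R : realType.
Local Notation C := (Cplx R).
Implicit Types (f g : C -> C) (z : C).

Lemma regular_atM f g z :
  regular_at f z -> regular_at g z -> regular_at (f * g) z.
Proof.
by move=> rf rg; apply: filterS2 rf rg => w; exact: derivableM.
Qed.

Lemma regular_at_cst c z : regular_at (cst c : C -> C) z.
Proof. by near=> w; exact: derivable_cst. Unshelve. all: by end_near. Qed.

Lemma regular_at_subX z (n : nat) : regular_at (fun w : C => (w - z) ^+ n) z.
Proof.
near=> w; have -> : (fun w : C => (w - z) ^+ n) = (id - cst z) ^+ n.
  by apply/funext => x; rewrite exprfctE.
by apply/derivableX/derivableB; [exact: derivable_id|exact: derivable_cst].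
Unshelve. all: by end_near. Qed.

Lemma regular_at_cvg f z : regular_at f z -> f w @[w --> z^'] --> f z.
Proof.
by move=> /nbhs_singleton/derivable1_diffP/differentiable_continuous/
  continuous_withinNx.
Qed.

Lemma has_order1 z : has_order (fun=> 1 : C) z 0.
Proof.
exists (cst 1); split; [exact: regular_at_cst|exact: oner_neq0|].
by near=> w; rewrite expr0z mulr1.
Unshelve. all: by end_near. Qed.

Lemma has_orderM f g z (k l : int) :
  has_order f z k -> has_order g z l -> has_order (fun w => f w * g w) z (k + l).
Proof.
move=> [f0 [rf f0z fE]] [g0 [rg g0z gE]]; exists (f0 * g0).
split; [exact: regular_atM|exact: mulf_neq0|].
near=> w; have -> : f w = (w - z) ^ k * f0 w by near: w.
have -> : g w = (w - z) ^ l * g0 w by near: w.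
rewrite expfzDr; first by rewrite mulrACA.
by rewrite subr_eq0; near: w; exact: nbhs_dnbhs_neq.
Unshelve. all: by end_near. Qed.

Lemma has_orderX f z (l : int) n :
  has_order f z l -> has_order (fun w => f w ^+ n) z (l *+ n).
Proof.
move=> fl; elim: n => [|n IHn].
  rewrite mulr0n (_ : (fun _ => _) = fun=> 1); first exact: has_order1.
  by apply/funext => w; rewrite expr0.
rewrite mulrS (_ : (fun _ => _) = fun w => f w * f w ^+ n).
  exact: has_orderM.
by apply/funext => w; rewrite exprS.
Qed.

Lemma has_order_prod r (f : 'I_r -> C -> C) z (l : 'I_r -> int) (a : 'I_r -> nat) :
  (forall j, has_order (f j) z (l j)) ->
  has_order (fun w => \prod_(j < r) f j w ^+ a j) z (\sum_(j < r) l j *+ a j).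
Proof.
move=> fl; elim: (index_enum _) => [|j s IHs].
  rewrite big_nil (_ : (fun _ => _) = fun=> 1); first exact: has_order1.
  by apply/funext => w; rewrite big_nil.
rewrite big_cons (_ : (fun _ => _) =
  fun w => f j w ^+ a j * \prod_(i <- s) f i w ^+ a i).
  exact/has_orderM/IHs/has_orderX.
by apply/funext => w; rewrite big_cons.
Qed.

(** For the direct implication, a function of negative order [- n.+1] cannot
    agree with a regular [h] near [z]: [(w - z) ^+ n.+1 * h w] would tend to [0],
    while its limit is the nonzero leading coefficient. *)
Lemma holomorphic_at_order f z (l : int) :
  has_order f z l -> holomorphic_at f z <-> 0 <= l.
Proof.
case=> g [rg gz fE]; split=> [[h rh fh]|]; case: l fE => n // fE; last first.
  move=> _; exists ((fun w : C => (w - z) ^+ n) * g); last exact: fE.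
  exact: regular_atM (regular_at_subX z n) rg.
have lim0 : (w - z) ^+ n.+1 * h w @[w --> z^'] --> (0 : C).
  have := regular_at_cvg (regular_atM (regular_at_subX z n.+1) rh).
  by rewrite /= mulrfctE subrr expr0n mul0r.
have : (w - z) ^+ n.+1 * h w @[w --> z^'] --> g z.
  apply: cvg_trans (regular_at_cvg rg); apply: near_eq_cvg.
  near=> w.
  have <- : f w = h w by near: w.
  have -> : f w = (w - z) ^ Negz n * g w by near: w.
  have wz : w - z != 0 by rewrite subr_eq0; near: w; exact: nbhs_dnbhs_neq.
  by rewrite NegzE -exprnN mulrA mulfV ?mul1r// expf_neq0.
by move=> /(cvg_unique (@norm_hausdorff _ C) lim0) gz0; rewrite -gz0 eqxx in gz.
Unshelve. all: by end_near. Qed.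

Lemma holomorphy_semigroupE r (f : 'I_r -> C -> C) z (l : 'I_r -> int) :
  (forall j, has_order (f j) z (l j)) ->
  holomorphy_semigroup f z = [set a | 0 <= \sum_(j < r) l j *+ a j].
Proof.
move=> fl; apply/funext => a; apply/propext.
exact/holomorphic_at_order/has_order_prod.
Qed.

End OrderOfVanishing.

(** * Monomials and toric ideals *)

Section MonomialCombinations.
Variables (m r : nat).
Implicit Types (u : 'I_m -> multinom r) (a b : multinom m).

(** The monoid morphism from exponent vectors in [t_1, ..., t_m] to exponent
    vectors in [x_1, ..., x_r] induced by [t_i |-> x^(u i)]. *)
Definition mnm_comb u a : multinom r :=
  \big[mnm_add/mnm0]_(i < m) mnm_muln (u i) (a i).

Lemma mnm_combE u a j : mnm_comb u a j = (\sum_(i < m) u i j * a i)%N.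
Proof. by rewrite mnm_sumE; apply: eq_bigr => i _; rewrite mulmnE. Qed.

Lemma mnm_comb0 u : mnm_comb u mnm0 = mnm0.
Proof.
by apply/mnmP => j; rewrite mnm_combE big1 ?mnm0E// => i _; rewrite mnm0E muln0.
Qed.

Lemma mnm_combD u a b :
  mnm_comb u (mnm_add a b) = mnm_add (mnm_comb u a) (mnm_comb u b).
Proof.
apply/mnmP => j; rewrite mnmDE !mnm_combE -big_split/=.
by apply: eq_bigr => i _; rewrite mnmDE mulnDr.
Qed.

Lemma mnm_combMn u a k :
  mnm_comb u (mnm_muln a k) = mnm_muln (mnm_comb u a) k.
Proof.
apply/mnmP => j; rewrite mulmnE !mnm_combE big_distrl/=.
by apply: eq_bigr => i _; rewrite mulmnE mulnA.
Qed.

Lemma mnm_comb1 u i : mnm_comb u (mnm1 i) = u i.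
Proof.
apply/mnmP => j; rewrite mnm_combE (bigD1 i)//= mnm1E eqxx muln1 big1 ?addn0//.
by move=> k ki; rewrite mnm1E eq_sym (negbTE ki) muln0.
Qed.

(** The unit vectors are indecomposable. *)
Lemma mnm_comb_eq1 u a j :
  mnm_comb u a = mnm1 j -> exists2 i, (0 < a i)%N & u i = mnm1 j.
Proof.
move=> E; have Ek k : (\sum_(i < m) u i k * a i)%N = (j == k).
  by rewrite -mnm_combE E mnm1E.
have [i _ uai] : exists2 i, true & (0 < u i j * a i)%N.
  apply/exists_inP; rewrite -[X in is_true X]negbK negb_exists.
  apply/negP => /forallP ua0; have := Ek j; rewrite eqxx big1// => i _.
  by apply/eqP; rewrite -leqn0 leqNgt; exact: ua0.
move: uai; rewrite muln_gt0 => /andP[uij ai]; exists i => //.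
have le k : (u i k <= (j == k))%N.
  rewrite -Ek (bigD1 i)//=; apply: leq_trans (leq_addr _ _).
  by rewrite leq_pmulr.
apply/mnmP => k; rewrite mnm1E; apply/eqP; rewrite eqn_leq le/=.
by case: eqP => // <-.
Qed.

Variable F : fieldType.

Lemma mmap1_mpolyX u a :
  mmap1 (fun i => mpolyX F (u i)) a = mpolyX F (mnm_comb u a).
Proof. exact: mprodXnE. Qed.

(** If two monomials in the [t_i] have the same image, their difference lies in
    the ideal. If no two have, the images are distinct monomials in the [x_j],
    hence linearly independent. *)
Lemma toric_ideal_eq0P u :
  toric_ideal F u = [set 0] <-> injective (mnm_comb u).
Proof.
split=> [I0 a b ab|inj].
  have : toric_ideal F u (mpolyX F a - mpolyX F b).
    by rewrite /toric_ideal/= mmapB !mmapX !mmap1_mpolyX ab subrr.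
  rewrite I0 => /eqP; rewrite subr_eq0 => /eqP/(congr1 (mcoeff a)).
  rewrite !mcoeffX eqxx; case: eqP => // _ /eqP.
  by rewrite oner_eq0.
apply/seteqP; split=> [p|_ ->]; last by rewrite /toric_ideal/= mmap0.
rewrite /toric_ideal/= => p0; apply/mpolyP => k; rewrite mcoeff0.
have := congr1 (mcoeff (mnm_comb u k)) p0; rewrite mcoeff0 /mmap raddf_sum/=.
under eq_bigr do rewrite mmap1_mpolyX mcoeffCM mcoeffX (inj_eq inj).
move=> <-; have [kp|kp] := boolP (k \in msupp p); last first.
  rewrite big_seq big1 => [|b bp]; first exact: memN_msupp_eq0.
  by case: eqP bp kp => [->->|]//; rewrite mulr0.
rewrite (bigD1_seq k)//= eqxx mulr1 big1 ?addr0// => b /negbTE ->.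
by rewrite mulr0.
Qed.

End MonomialCombinations.

(** * Semigroup algebras and their monomial generators *)

Section SemigroupAlgebra.
Variables (F : fieldType) (r : nat).
Implicit Types (H : set (multinom r)) (a : multinom r).

Lemma semigroup_algX H a : semigroup_alg F H (mpolyX F a) <-> H a.
Proof.
split=> [[s [c [sH E]]]|Ha]; last first.
  exists [:: a], (fun=> 1); rewrite big_seq1 scale1r; split=> // b.
  by rewrite inE => /eqP ->.
have [/sH//|/negP as_] := boolP (a \in s).
have := congr1 (mcoeff a) E; rewrite mcoeffX eqxx raddf_sum/= big_seq big1.
  by move=> /eqP; rewrite oner_eq0.
move=> b bs; rewrite mcoeffZ mcoeffX; case: eqP bs => [->//|_ _].
by rewrite mulr0.
Qed.

Lemma semigroup_algT : semigroup_alg F [set: multinom r] = [set: mpoly r F].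
Proof.
apply/seteqP; split=> // p _; exists (msupp p), (fun a => mcoeff a p).
by split=> //; exact: mpolyE.
Qed.

Lemma generated_subalg_sub (U : set (mpoly r F)) : U `<=` generated_subalg U.
Proof. by move=> x Ux S _; apply. Qed.

Section Generators.
Variables (m : nat) (u : 'I_m -> multinom r) (H : set (multinom r)).
Hypothesis genu : monomials_generate F H (range u).

Lemma monomials_generate_mem i : H (u i).
Proof.
apply/semigroup_algX; rewrite -genu; apply: generated_subalg_sub.
by exists (u i) => //; exists i.
Qed.

(** The polynomials whose exponents are combinations of the [u i] form a
    subalgebra, which contains the generators. *)
Lemma monomials_generate_comb a : H a -> exists c, a = mnm_comb u c.
Proof.
move=> /semigroup_algX; rewrite -genu => Xa.
pose P : pred (mpoly r F) :=
  fun p => `[< forall b, b \in msupp p -> exists c, b = mnm_comb u c >].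
suff: mpolyX F a \in P.
  by rewrite unfold_in => /asboolP; apply; rewrite msuppX mem_head.
apply: Xa.
- split.
  + rewrite unfold_in; apply/asboolP => b; rewrite msupp1 inE => /eqP ->.
    by exists mnm0; rewrite mnm_comb0.
  + move=> k p q; rewrite !unfold_in => /asboolP pP /asboolP qP.
    apply/asboolP => b /msuppD_le; rewrite mem_cat => /orP[/msuppZ_le|].
      exact: pP.
    exact: qP.
  + move=> p q; rewrite !unfold_in => /asboolP pP /asboolP qP.
    apply/asboolP => b /msuppM_le/allpairsP[[b1 b2]/= [/pP[c1 ->] /qP[c2 ->] ->]].
    by exists (mnm_add c1 c2); rewrite mnm_combD.
- move=> _ [_ [i _ <-] <-]; rewrite unfold_in; apply/asboolP => b.
  rewrite msuppX inE => /eqP ->; exists (mnm1 i).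
  by rewrite mnm_comb1.
Qed.

End Generators.

Lemma monomials_generate_units :
  monomials_generate F [set: multinom r] (range (@mnm1 r)).
Proof.
rewrite /monomials_generate semigroup_algT; apply/seteqP; split=> // p _ S.
case=> S1 Slin SM SU.
have S0 : 0 \in S by have := Slin (-1) _ _ S1 S1; rewrite scaleN1r addNr.
rewrite (mpolyE p); elim: (msupp p : seq _) => [|a s IHs]; first by rewrite big_nil.
rewrite big_cons; apply: Slin IHs; rewrite mpolyXE_id.
elim: (index_enum _) => [|j t IHt]; first by rewrite big_nil.
rewrite big_cons; apply: (SM) IHt; elim: (a j) => [|k IHk]; first by rewrite expr0.
by rewrite exprS; apply: (SM) IHk; apply: SU; exists (mnm1 j) => //; exists j.
Qed.

(** The minimal monomial generators of the full polynomial ring are the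
    variables: these generate it, and being indecomposable they belong to every
    set of monomial generators. *)
Lemma minimal_generators_setT m (u : 'I_m -> multinom r) : injective u ->
  minimal_monomial_generators F [set: multinom r] (range u) ->
  injective (mnm_comb u).
Proof.
move=> u_inj [genu u_min].
have units_range : range (@mnm1 r) = range u.
  apply: u_min; last exact: monomials_generate_units.
  move=> _ [j _ <-]; have [c cE] := monomials_generate_comb genu (a := mnm1 j) I.
  by have [i _ ui] := mnm_comb_eq1 (esym cE); exists i.
have /choice[s sE] : forall i, exists j, u i = mnm1 j.
  move=> i; have : range u (u i) by exists i.
  by rewrite -units_range => -[j _ <-]; exists j.
have comb_s c i : mnm_comb u c (s i) = c i.
  rewrite mnm_combE (bigD1 i)//= sE mnm1E eqxx mul1n big1 ?addn0// => k ki.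
  rewrite sE mnm1E; case: eqP => // ski.
  by move: ki; rewrite (u_inj k i) ?eqxx// !sE ski.
by move=> a b ab; apply/mnmP => i; rewrite -!comb_s ab.
Qed.

End SemigroupAlgebra.

(** * Weights of exponent vectors *)

Section Weights.
Variables (r : nat) (l : 'I_r -> int).

(** The linear form [a |-> a_1 l_1 + ... + a_r l_r] that defines the semigroup. *)
Definition mnm_weight (a : multinom r) : int := \sum_(j < r) l j *+ a j.

Lemma mnm_weight1 j : mnm_weight (mnm1 j) = l j.
Proof.
rewrite /mnm_weight (bigD1 j)//= mnm1E eqxx mulr1n big1 ?addr0// => k kj.
by rewrite mnm1E eq_sym (negbTE kj).
Qed.

Lemma mnm_weightD a b :
  mnm_weight (mnm_add a b) = mnm_weight a + mnm_weight b.
Proof.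
by rewrite -big_split; apply: eq_bigr => j _; rewrite mnmDE mulrnDr.
Qed.

Lemma mnm_weightMn a k : mnm_weight (mnm_muln a k) = mnm_weight a *+ k.
Proof.
by rewrite -sumrMnl; apply: eq_bigr => j _; rewrite mulmnE mulrnA.
Qed.

Lemma mnm_weight_comb m (u : 'I_m -> multinom r) c :
  mnm_weight (mnm_comb u c) = \sum_(i < m) mnm_weight (u i) *+ c i.
Proof.
rewrite /mnm_weight; under [RHS]eq_bigr do rewrite -sumrMnl.
rewrite exchange_big; apply: eq_bigr => j _; rewrite mnm_combE -sumrMnr.
by apply: eq_bigr => i _; rewrite mulrnA.
Qed.

Lemma ge0_mnm_weight a : (forall j, 0 <= l j) -> 0 <= mnm_weight a.
Proof. by move=> l0; apply: sumr_ge0 => j _; rewrite mulrn_wge0. Qed.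

(** If the semigroup [0 <= mnm_weight a] is free on the [u i] and some [l n] is
    negative, at most one [l p] is positive. With [l n < 0 < l p, l q], the
    vectors [vp = |l n| e_p + l_p e_n] and [vq = |l n| e_q + l_q e_n] have weight
    zero and satisfy [l_q vp + l_p |l n| e_q = l_p vq + l_q |l n| e_p]. The
    generator [e_p] occurs on the right; it cannot occur on the left unless
    [p = q], because all generators occurring in [vp] have weight zero. *)
Lemma free_at_most_one_positive m (u : 'I_m -> multinom r) (n p q : 'I_r) :
  injective (mnm_comb u) -> (forall i, 0 <= mnm_weight (u i)) ->
  (forall a, 0 <= mnm_weight a -> exists c, a = mnm_comb u c) ->
  l n < 0 -> 0 < l p -> 0 < l q -> p = q.
Proof.
move=> inj u_ge0 gen ln lp lq; apply/eqP/negPn/negP => pq.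
pose c := `|l n|%N; pose A := `|l p|%N; pose B := `|l q|%N.
have cE : l n = - c%:Z by rewrite /c; lia.
have AE : l p = A by rewrite /A; lia.
have BE : l q = B by rewrite /B; lia.
have [cp cpE] : exists c, mnm1 p = mnm_comb u c.
  by apply: gen; rewrite mnm_weight1 ltW.
have [cq cqE] : exists c, mnm1 q = mnm_comb u c.
  by apply: gen; rewrite mnm_weight1 ltW.
pose v (j : 'I_r) k := mnm_add (mnm_muln (mnm1 j) c) (mnm_muln (mnm1 n) k).
have v0 j (k : nat) : l j = k -> mnm_weight (v j k) = 0.
  rewrite mnm_weightD !mnm_weightMn !mnm_weight1 cE => ->.
  by rewrite !pmulrn !mulrzz mulNr mulrC subrr.
have vp0 : mnm_weight (v p A) = 0 by exact: v0.
have [dp dpE] : exists c, v p A = mnm_comb u c by apply: gen; rewrite vp0.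
have [dq dqE] : exists c, v q B = mnm_comb u c by apply: gen; rewrite v0.
have [i cpi ui] := mnm_comb_eq1 (esym cpE).
(* By freeness, the relation between the four vectors holds between their
   decompositions; it is now read off at the coordinate [i] of [e_p]. *)
have : mnm_add (mnm_muln dp B) (mnm_muln cq (A * c))
     = mnm_add (mnm_muln dq A) (mnm_muln cp (B * c)).
  apply: inj; rewrite !mnm_combD !mnm_combMn -cpE -cqE -dpE -dqE.
  apply/mnmP => j; rewrite !(mnmDE, mulmnE); lia.
move=> /(congr1 (fun b : multinom m => b i)); rewrite !(mnmDE, mulmnE).
(* The weights of the generators occurring in [v p A] are nonnegative with sum
   zero, while [u i] has weight [l p]. *)
have -> : dp i = 0%N.
  move: vp0; rewrite dpE mnm_weight_comb => /eqP.
  rewrite psumr_eq0; last by move=> k _; rewrite mulrn_wge0.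
  move=> /allP/(_ i (mem_index_enum _))/=.
  by rewrite ui mnm_weight1 mulrn_eq0 => /orP[/eqP//|]; rewrite gt_eqF.
have -> : cq i = 0%N.
  have : mnm_comb u cq p = 0%N by rewrite -cqE mnm1E eq_sym (negbTE pq).
  rewrite mnm_combE => /eqP; rewrite sum_nat_eq0 => /forallP/(_ i)/=.
  by rewrite ui mnm1E eqxx mul1n => /eqP.
rewrite !mul0n addn0 => /esym/eqP; rewrite addn_eq0 !muln_eq0; lia.
Qed.

End Weights.

(** * Counting supports *)

Lemma card_draws_mem (T : finType) (p : T) t : (0 < t)%N ->
  (#|[set A : {set T} | (p \in A) && (#|A| == t)]%SET| <= 'C(#|T|.-1, t.-1))%N.
Proof.
move=> t0.
have -> : #|T|.-1 = #|[set~ p]%SET| by rewrite cardsC1.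
rewrite -cards_draws; set D := [set A : {set T} | A \subset _ & _]%SET.
apply: leq_trans (leq_imset_card (fun B => p |: B)%SET D).
apply/subset_leq_card/fintype.subsetP => A; rewrite inE => /andP[pA /eqP At].
apply/imsetP; exists (A :\ p)%SET; last by rewrite finset.setD1K.
rewrite inE; apply/andP; split.
  by apply/fintype.subsetP => x; rewrite !inE => /andP[].
by rewrite -At (cardsD1 p A) pA.
Qed.

(** By Pascal's rule applied twice, ['C(r, t)] exceeds the left-hand side by
    ['C(r-2, t-1)], which is positive. *)
Lemma N_gt r t : (1 <= t <= r - 1)%N ->
  ('C(r.-1, t.-1) + 'C(r.-2, t) < N_ r t)%N.
Proof.
case: r t => [|[|r]] [|t]// /andP[_]; rewrite subn1/= ltnS => tr.
rewrite /N_/= leq_min addn1 leqnn/= !binS.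
by have : (0 < 'C(r, t))%N; [rewrite bin_gt0|lia].
Qed.

Lemma L_setT (F : fieldType) r t : L_ F [set: multinom r] t = 'C(r, t).
Proof.
rewrite /L_ -[r in RHS]card_ord -card_draws; apply: eq_card => A; rewrite !inE.
apply/asboolP/eqP => [[a _ [_ At]]//|At].
pose a : multinom r := Multinom [tuple nat_of_bool (j \in A) | j < r].
exists a; first exact/semigroup_algX.
by split=> //; apply/setP => j; rewrite inE multinomE tnth_mktuple lt0b.
Qed.

(** Every support contains [p] or avoids both [p] and [n]; there are
    ['C(r-1, t-1)] sets of size [t] of the first kind and ['C(r-2, t)] of the
    second. *)
Lemma L_le (F : fieldType) r (H : set (multinom r)) (n p : 'I_r) t :
  p != n -> (0 < t)%N ->
  (forall a, H a -> (0 < a n)%N -> (0 < a p)%N) ->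
  (L_ F H t <= 'C(r.-1, t.-1) + 'C(r.-2, t))%N.
Proof.
move=> pn t0 Hnp.
have cardN : #|~: [set p; n]%SET| = r.-2.
  by have := cardsC [set p; n]%SET; rewrite cards2 pn card_ord; lia.
have := card_draws_mem p t0; rewrite card_ord.
set D := [set A | _]%SET => leD.
apply: leq_trans (leq_add leD (leqnn _)); rewrite -cardN -cards_draws.
apply: leq_trans (leq_card_setU _ _).
apply/subset_leq_card/fintype.subsetP => A; rewrite !inE.
move=> [a /semigroup_algX Ha [<- ->]]; rewrite eqxx !andbT.
have [//|pa] := boolP (p \in mon_supp a).
apply/fintype.subsetP => j; rewrite !inE => ja; apply/negP => /orP[]/eqP jE.
  by move: pa; rewrite inE -jE ja.
by move: pa; rewrite inE Hnp// -jE.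
Qed.

(** * Artin's conjecture at a point *)

Theorem theorem1p6 (R : realType)
  (K : splittingFieldType rat) (galK : galois 1%AS {:K})
  (r : nat) (r_gt1 : (1 < r)%N)
  (chi : 'I_r -> {ffun gal_of {:K} -> complex R})
  (chi_inj : injective chi)
  (chi_irr : forall psi : {ffun gal_of {:K} -> complex R},
     irreducible_character psi <-> exists j, chi j = psi)
  (f : 'I_r -> Cplx R -> Cplx R)
  (fL : forall j, artin_L_function (chi j) (f j))
  (s0 : Cplx R) (s0_neq1 : s0 != 1)
  (l : 'I_r -> int) (ord_f : forall j, has_order (f j) s0 (l j))
  (F : fieldType) (cst : {rmorphism complex R -> F})
  (ev : F -> Cplx R -> Cplx R) (F_between : field_between cst ev)
  (m : nat) (u : 'I_m -> multinom r) (u_inj : injective u)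
  (u_min : minimal_monomial_generators F (holomorphy_semigroup f s0) (range u)) :
  let H := holomorphy_semigroup f s0 in
  let I_H := toric_ideal F u in
  [<-> (forall j, holomorphic_at (f j) s0);
       semigroup_alg F H = [set: mpoly r F];
       I_H = [set 0] /\
         (forall t : nat, (1 <= t <= r - 1)%N -> (N_ r t <= L_ F H t)%N);
       I_H = [set 0] /\
         (exists t : nat, (1 <= t <= r - 1)%N /\ (N_ r t <= L_ F H t)%N)].
Proof.
move=> H I_H.
have HE : H = [set a | 0 <= mnm_weight l a] := holomorphy_semigroupE ord_f.
have holE j : holomorphic_at (f j) s0 <-> 0 <= l j.
  exact: holomorphic_at_order.
have genu : monomials_generate F H (range u) := u_min.1.
tfae.
- move=> hol; suff -> : H = setT by exact: semigroup_algT.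
  rewrite HE; apply/seteqP; split=> // a _ /=; apply: ge0_mnm_weight => j.
  exact/holE.
- move=> algT; have HT : H = setT.
    by apply/seteqP; split=> // a _; apply/(semigroup_algX F); rewrite algT.
  split; last by move=> t _; rewrite HT L_setT geq_minr.
  apply/toric_ideal_eq0P; apply: (minimal_generators_setT (F := F) u_inj).
  by rewrite -HT.
- by case=> I0 NL; split=> //; exists 1%N; split; [lia|apply: NL; lia].
case=> /toric_ideal_eq0P free [t [t_bnd NL]] n; apply/holE; rewrite leNgt.
apply/negP => ln; move: NL; apply/negP; rewrite -ltnNge.
have [p pn le0] : exists2 p, p != n & forall j, j != p -> l j <= 0.
  have [[p lp]|no] := pselect (exists p, 0 < l p).
    exists p; first by apply/eqP => pn; move: lp; rewrite pn ltNge ltW.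
    move=> j jp; rewrite leNgt; apply/negP => lj; move/eqP: jp; apply.
    apply: (free_at_most_one_positive free) ln lj lp => [i|a a0].
      by have := monomials_generate_mem genu i; rewrite HE.
    by apply: (monomials_generate_comb genu); rewrite HE.
  have [p pn] : exists p : 'I_r, p != n.
    have /card_gt0P[p] : (0 < #|[set~ n]%SET|)%N by rewrite cardsC1 card_ord; lia.
    by rewrite !inE => pn; exists p.
  by exists p => // j _; rewrite leNgt; apply/negP => lj; apply: no; exists j.
apply: leq_ltn_trans (N_gt t_bnd); apply: (L_le _ pn); first by case/andP: t_bnd.
(* If [p] is outside the support, all terms of the weight are nonpositive and
   the one at [n] is negative. *)
move=> a; rewrite HE /= => a0 an; rewrite lt0n; apply/eqP => ap0.
move: a0; rewrite /mnm_weight (bigD1 n)//= leNgt => /negP; apply.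
rewrite ltr_wnDr ?pmulrn_llt0// sumr_le0// => j _.
have [->|jp] := eqVneq j p; first by rewrite ap0.
by rewrite mulrn_wle0 ?le0.
Qed.
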